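(* Let $K\subseteq\mathbb{C}$ be a field, let $r<\frac{d+2}{2}$, and let $f(x,y)\in K[x,y]$ be a binary form of degree $d$ with $L_{\mathbb{C}}(f)=r$. Then there exists a field extension $S/K$ (with $S\subseteq\mathbb{C}$) such that $L_S(f)=r$ and $[S:K]$ divides $r!$.
   Context: For a field $F\subseteq\mathbb{C}$ and a binary form (homogeneous polynomial in $x,y$) $f\in F[x,y]$ of degree $d$, the $F$-rank $L_F(f)$ is the smallest $r$ for which there exist $\lambda_j,\alpha_j,\beta_j\in F$ with $f(x,y)=\sum_{j=1}^r\lambda_j(\alpha_jx+\beta_jy)^d$. $[S:K]$ denotes the degree of the field extension $S/K$. *)

(* Defs.v *)
From HB Require Import structures.
From mathcomp Require Import all_boot all_order all_algebra all_field.
From mathcomp Require Import reals complex mpoly.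

Set Implicit Arguments.
Unset Strict Implicit.
Unset Printing Implicit Defensive.

Import GRing.Theory.
Local Open Scope ring_scope.

(* A subfield K of a field F is a value of type [divringClosed F]: a subset of
   F containing 1 and closed under x - y and x / y.  Its carrier is made a
   fieldType here so that it can serve as the base of a [fieldExtType]. *)
Definition subfield_type (F : fieldType) (K : divringClosed F) :=
  {x : F | x \in K}.

Section SubfieldType.
Variables (F : fieldType) (K : divringClosed F).
HB.instance Definition _ := SubChoice.on (subfield_type K).
HB.instance Definition _ :=
  [SubChoice_isSubComUnitRing of subfield_type K by <:].
HB.instance Definition _ :=
  [SubComUnitRing_isSubIntegralDomain of subfield_type K by <:].
HB.instance Definition _ :=
  [SubIntegralDomain_isSubField of subfield_type K by <:].
End SubfieldType.

(* [S : K] = n for subfields K, S of F.  The library measures degrees of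
   abstract finite extensions L of K; here L is identified with the subset S
   by a K-embedding iota of L into F with image S (so K is contained in S). *)
Definition has_ext_degree (F : fieldType) (K S : divringClosed F) (n : nat)
    : Prop :=
  exists (L : fieldExtType (subfield_type K)) (iota : {rmorphism L -> F}),
    [/\ forall a : subfield_type K, iota a%:A = val a,
        forall x : F, x \in S <-> exists y : L, iota y = x
      & \dim {:L} = n].

Definition binary_form (C : fieldType) (F : {pred C}) (d : nat)
    (f : {mpoly C[2]}) : Prop :=
  f \is d.-homog /\ f \is a mpolyOver 2 F.

Definition has_decomposition (C : fieldType) (F : {pred C}) (d : nat)
    (f : {mpoly C[2]}) (r : nat) : Prop :=
  exists lambda alpha beta : 'I_r -> C,
    (forall j, [/\ lambda j \in F, alpha j \in F & beta j \in F]) /\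
    f = \sum_(j < r) lambda j *: (alpha j *: 'X_0 + beta j *: 'X_1) ^+ d.

(* L_F(f) = r.  The degree d is a parameter because f = 0 does not determine
   it. *)
Definition has_rank (C : fieldType) (F : {pred C}) (d : nat)
    (f : {mpoly C[2]}) (r : nat) : Prop :=
  has_decomposition F d f r /\
  forall r' : nat, has_decomposition F d f r' -> (r <= r')%N.

(* Main.v *)
(** After a substitution y := y + m x with m a natural number, a minimal
    decomposition reads f = sum_j mu_j (x + rho_j y)^d with distinct rho_j and
    nonzero mu_j, and the numbers c_i = sum_j mu_j rho_j^i, i <= d, lie in K
    because they are coefficients of f up to binomials.  As 2r <= d + 1, the
    first 2r of them determine the node polynomial prod_j (X - rho_j) through an
    invertible Hankel system over K (Sylvester), so this polynomial of degree r
    is defined over K.  Let S be its splitting field in C: its degree divides r!,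
    it contains the rho_j, and it contains the mu_j by solving a Vandermonde
    system. *)
Require Import Defs.
From HB Require Import structures.
From mathcomp Require Import all_boot all_order all_algebra all_field.
From mathcomp Require Import reals complex mpoly.
From mathcomp Require boolp.

Set Implicit Arguments.
Unset Strict Implicit.
Unset Printing Implicit Defensive.

Import GRing.Theory.
Local Open Scope ring_scope.

(** * Splitting fields realised inside the large field *)

Lemma dvdn_fact_mul (a b : nat) : (a`! * b`! %| (a + b)`!)%N.
Proof. by rewrite -(bin_fact (leq_addr b a)) addKn dvdn_mull. Qed.

(** Restriction of scalars: the field [L2], seen over [K], keeps its embedding [j2], and degrees
    multiply. *)
Lemma tower_embedding (K C : fieldType) (L1 : fieldExtType K)
    (L2 : fieldExtType L1) (iota : {rmorphism K -> C})
    (j1 : {rmorphism L1 -> C}) (j2 : {rmorphism L2 -> C}) :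
  (forall a, j1 a%:A = iota a) -> (forall a, j2 a%:A = j1 a) ->
  exists (L : fieldExtType K) (j : {rmorphism L -> C}),
  [/\ forall a, j a%:A = iota a,
      \dim {:L} = (\dim {:L1} * \dim {:L2})%N
    & forall x, (exists y, j2 y = x) -> exists y, j y = x].
Proof.
move=> j1E j2E; exists (baseFieldType L2 : fieldExtType K).
exists (j2 : {rmorphism baseFieldType L2 -> C}); split => //.
- by move=> a; rewrite -j1E -j2E baseField_scaleE.
- rewrite mulnC -dim_baseVspace; congr (\dim _).
  apply/vspaceP => v; rewrite mem_baseVspace memvf.
  by apply/esym; apply: (@memvf _ L2 v).
Qed.

(* An irreducible [p] is treated by adjoining one root, which contributes the
   factor [deg p] of [(deg p)!]; for reducible [p = u * q] one splits [q], then
   [u], and uses that [a! * b!] divides [(a + b)!]. *)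
Lemma splitting_embedding (K : fieldType) (C : closedFieldType)
    (iota : {rmorphism K -> C}) (p : {poly K}) : p != 0 ->
  exists (L : fieldExtType K) (j : {rmorphism L -> C}),
  [/\ forall a, j a%:A = iota a,
      (\dim {:L} %| (size p).-1`!)%N
    & forall x, root (map_poly iota p) x -> exists y, j y = x].
Proof.
have [n] := ubnP (size p).
(* The base field and its embedding vary in the induction, since the remaining factor is split over
   [L1]. *)
elim: n => // n IHn in K iota p *; rewrite ltnS => le_pn nz_p.
have [sz_p | sz_p] := leqP (size p) 1.
  exists (K^o : fieldExtType K), (iota : {rmorphism K^o -> C}); split.
  - by move=> a; apply: (congr1 iota (mulr1 a)).
  - by rewrite dimvf dvd1n.
  - move=> x; have /size_poly1P[a nz_a ->] : size p == 1%N.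
      by rewrite eqn_leq sz_p lt0n size_poly_eq0.
    by rewrite map_polyC rootC fmorph_eq0 (negPf nz_a).
case: (boolp.EM (irreducible_poly p)) => [irr_p | red_p].
  have /closed_rootP[z rz] : size (map_poly iota p) != 1%N.
    by rewrite size_map_poly neq_ltn sz_p orbT.
  pose L1 : fieldExtType K := SubFieldExtType rz irr_p.
  pose j1 : {rmorphism L1 -> C} := @subfx_inj _ _ iota z p.
  have j1E a : j1 a%:A = iota a by apply: subfx_inj_base.
  pose z1 : L1 := subfx_root iota z p.
  have j1z : j1 z1 = z by apply: subfx_inj_root.
  have mapj q : map_poly j1 (map_poly (in_alg L1) q) = map_poly iota q.
    by rewrite -map_poly_comp; apply: eq_map_poly => a; apply: j1E.
  have [q Dq] : exists q, map_poly (in_alg L1) p = q * ('X - z1%:P).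
    by apply/factor_theorem; rewrite -(fmorph_root j1) mapj j1z.
  have nz_q : q != 0.
    apply/eqP => q0; move/eqP: Dq.
    by rewrite q0 mul0r map_poly_eq0 (negPf nz_p).
  have sz_q : size p = (size q).+1.
    by rewrite -(size_map_poly (in_alg L1)) Dq size_Mmonic ?monicXsubC //
               size_XsubC addn2.
  have [|L2 [j2 [j2E dvd2 root2]]] := IHn L1 j1 q _ nz_q.
    by rewrite -sz_q.
  have [L [j [jE dimL imj]]] := tower_embedding j1E j2E.
  exists L, j; split => //.
    have dim1 : \dim {:L1} = (size p).-1 by rewrite dimvf.
    have sz_q1 : (size p).-1 = (size q).-1.+1.
      by rewrite sz_q prednK // lt0n size_poly_eq0.
    by rewrite dimL dim1 sz_q1 factS dvdn_mul.
  move=> x; rewrite -mapj Dq rmorphM /= map_polyXsubC j1z rootM root_XsubC.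
  case/orP=> [/root2/imj // | /eqP ->].
  by apply: imj; exists z1%:A; rewrite j2E.
have [q [sz_q q_dv_p neq_qp]] :
    exists q : {poly K}, [/\ size q != 1%N, q %| p & ~ (q %= p)].
  apply/boolp.not_existsP => no_q; apply: red_p; split=> // q sz_q dv_q.
  by apply/negPn/negP => /negP neq_qp; apply: (no_q q).
have [u Dp] : exists u, p = u * q by apply/dvdpP.
have nz_u : u != 0 by apply: contraNneq nz_p => u0; rewrite Dp u0 mul0r.
have nz_q : q != 0 by apply: contraNneq nz_p => q0; rewrite Dp q0 mulr0.
have sz_uq : (size p).-1 = ((size u).-1 + (size q).-1)%N.
  rewrite Dp size_mul // -(prednK (n := size u)) ?lt0n ?size_poly_eq0 //.
  by rewrite -(prednK (n := size q)) ?lt0n ?size_poly_eq0 // addSn addnS.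
have lt_qp : (size q < size p)%N.
  rewrite ltn_neqAle dvdp_leq // andbT dvdp_size_eqp //.
  exact/negP.
have lt_up : (size u < size p)%N.
  move: sz_uq sz_q nz_q nz_u sz_p; rewrite -!size_poly_eq0.
  case: (size u) (size q) (size p) => [//|a] [//|[//|b]] [//|e] /= -> _ _ _ _.
  by rewrite addnS ltnS ltnS leq_addr.
have [|L1 [j1 [j1E dvd1 root1]]] := IHn K iota q _ nz_q.
  exact: leq_trans lt_qp le_pn.
have [||L2 [j2 [j2E dvd2 root2]]] := IHn L1 j1 (map_poly (in_alg L1) u).
- by rewrite size_map_poly (leq_trans lt_up).
- by rewrite map_poly_eq0.
have [L [j [jE dimL imj]]] := tower_embedding j1E j2E.
exists L, j; split=> //.
  rewrite dimL; rewrite size_map_poly in dvd2.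
  apply: dvdn_trans (dvdn_mul dvd1 dvd2) _.
  by rewrite sz_uq addnC dvdn_fact_mul.
move=> x; rewrite Dp rmorphM rootM /= => /orP[ru | /root1[y <-]].
  apply/imj/root2; rewrite -map_poly_comp.
  by rewrite (eq_map_poly (g := iota)) // => a; apply: j1E.
by apply: imj; exists y%:A; rewrite j2E.
Qed.

(** This turns an abstract extension into a subset of [F]; membership in the image is made boolean
    classically. *)
Lemma image_subfield (L F : fieldType) (j : {rmorphism L -> F}) :
  exists S : divringClosed F, forall x, x \in S <-> exists y, j y = x.
Proof.
pose P : {pred F} := fun x => boolp.asbool (exists y, j y = x).
have PP x : x \in P <-> exists y, j y = x.
  by rewrite unfold_in; split=> /boolp.asboolP.
have closedP : divring_closed P.
  split=> [|x y /PP[a <-] /PP[b <-]|x y /PP[a <-] /PP[b <-]]; apply/PP.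
  - by exists 1; rewrite rmorph1.
  - by exists (a - b); rewrite rmorphB.
  - by exists (a / b); rewrite fmorph_div.
pose S : divringClosed F := HB.pack P (GRing.isDivringClosed.Build F P closedP).
by exists S.
Qed.

(** * Descent of nodes and weights by Hankel and Vandermonde systems *)

Lemma unitmx_Vandermonde (F : fieldType) (r : nat) (rho : 'I_r -> F) :
  injective rho -> Vandermonde r (\row_j rho j) \in unitmx.
Proof.
move=> inj_rho; rewrite unitmxE det_Vandermonde unitfE.
apply/prodf_neq0 => i _; apply/prodf_neq0 => k lt_ik.
by rewrite !mxE subr_eq0 (inj_eq inj_rho) neq_ltn lt_ik orbT.
Qed.

(* With [V] the Vandermonde matrix of the nodes, the Hankel matrix [c (k + i)]
   of the moments is [V * diag mu * V^T], hence invertible over [K]; the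
   non-leading coefficients of the node polynomial solve a linear system with
   this matrix and right-hand side in [K]. *)
Lemma node_poly_descent (K F : fieldType) (iota : {rmorphism K -> F}) (r : nat)
    (mu rho : 'I_r -> F) (c : nat -> K) :
  injective rho -> (forall j, mu j != 0) ->
  (forall i, (i < r.*2)%N -> iota (c i) = \sum_j mu j * rho j ^+ i) ->
  exists p : {poly K}, map_poly iota p = \prod_j ('X - (rho j)%:P).
Proof.
move=> inj_rho nz_mu cE; set h := \prod_j _.
have sz_h : size h = r.+1 by rewrite /h -big_enum size_prod_XsubC size_enum_ord.
have mon_h : h \is monic by apply: monic_prod => j _; apply: monicXsubC.
have h_r : h`_r = 1 by move/monicP: mon_h; rewrite lead_coefE sz_h.
have h_root j : \sum_(i < r) rho j ^+ i * h`_i = - rho j ^+ r.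
  have : h.[rho j] = 0 by rewrite /h (bigD1 j) //= !hornerE subrr mul0r.
  rewrite horner_coef sz_h big_ord_recr /= h_r mul1r => /eqP.
  rewrite addr_eq0 => /eqP <-; apply: eq_bigr => i _; exact: mulrC.
pose V := Vandermonde r (\row_j rho j).
pose A : 'M[K]_r := \matrix_(k, i) c (k + i)%N.
pose b : 'cV[K]_r := \col_k c (k + r)%N.
(* The largest index used is [(r - 1) + r], so the first [r.*2] moments suffice. *)
have cE' k i : (k < r)%N -> (i <= r)%N ->
    iota (c (k + i)%N) = \sum_j mu j * rho j ^+ (k + i).
  by move=> lt_kr le_ir; apply: cE; rewrite -addnn -addSn leq_add.
have AE : map_mx iota A = V *m diag_mx (\row_j mu j) *m V^T.
  apply/matrixP => k i; rewrite mul_mx_diag !mxE cE' ?(ltnW (ltn_ord i)) //.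
  apply: eq_bigr => j _; rewrite !mxE exprD mulrA; congr (_ * _); exact: mulrC.
have unitA : A \in unitmx.
  rewrite -(map_unitmx iota) AE !unitmx_mul unitmx_tr unitmx_Vandermonde //.
  rewrite andbT /= unitmxE det_diag unitfE; apply/prodf_neq0 => j _.
  by rewrite mxE.
have hE : \col_(i < r) h`_i = map_mx iota (- (invmx A *m b)).
  (* Row [k] is the relation [h_root j] times [mu j * rho j ^+ k], summed over [j]. *)
  have AhE : map_mx iota A *m (\col_(i < r) h`_i) = - map_mx iota b.
    apply/colP => k; rewrite !mxE cE' //.
    under eq_bigr => i _ do
      rewrite !mxE cE' ?(ltnW (ltn_ord i)) // mulr_suml.
    rewrite exchange_big -sumrN; apply: eq_bigr => j _ /=.
    under eq_bigr => i _ do rewrite exprD mulrA -mulrA.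
    by rewrite -mulr_sumr h_root mulrN exprD mulrA.
  rewrite map_mxN map_mxM map_invmx -mulmxN -AhE mulKmx //.
  by rewrite map_unitmx.
exists ('X^r + rVpoly (- (invmx A *m b))^T).
rewrite rmorphD /= map_polyXn map_rVpoly -map_trmx -hE.
apply/polyP => i; rewrite coefD coefXn.
have [lt_ir | le_ri] := ltnP i r.
  rewrite (ltn_eqF lt_ir) add0r (coef_rVpoly_ord _ (Ordinal lt_ir)).
  by rewrite !mxE.
rewrite [X in _ + X]nth_default ?(leq_trans (size_poly _ _)) // addr0.
have [-> | ne_ir] := eqVneq i r; first by rewrite h_r.
by rewrite [RHS]nth_default // sz_h ltn_neqAle eq_sym ne_ir.
Qed.

(** The first [r] moment equations form a linear system for [mu] with data in [K] and an invertible
    Vandermonde matrix. *)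
Lemma weight_descent (K F : fieldType) (iota : {rmorphism K -> F}) (r : nat)
    (mu : 'I_r -> F) (rho : 'I_r -> K) (c : nat -> K) :
  injective rho ->
  (forall i, (i < r)%N -> iota (c i) = \sum_j mu j * iota (rho j) ^+ i) ->
  forall j, exists a, iota a = mu j.
Proof.
move=> inj_rho cE j; pose V := Vandermonde r (\row_j rho j).
have unitV : map_mx iota V \in unitmx.
  by rewrite map_unitmx unitmx_Vandermonde.
exists ((invmx V *m (\col_i c i)) j 0).
suff : map_mx iota (invmx V *m (\col_i c i)) = \col_i mu i.
  by move/colP/(_ j); rewrite !mxE.
rewrite map_mxM map_invmx -[RHS](mulKmx unitV).
congr (_ *m _); apply/colP => i; rewrite !mxE cE //.
by apply: eq_bigr => k _; rewrite !mxE rmorphXn mulrC.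
Qed.

(** * Normal form of a minimal decomposition *)

Lemma exists_nat_nonroot (F : numFieldType) (p : {poly F}) :
  p != 0 -> exists m : nat, ~~ root p m%:R.
Proof.
move=> nz_p; apply/boolp.not_existsP => all_root.
pose rs : seq F := [seq m%:R | m <- iota 0 (size p)].
have : (size rs < size p)%N.
  apply: max_poly_roots => //.
    by apply/allP => _ /mapP[m _ ->]; apply/negPn/negP/all_root.
  by rewrite map_inj_uniq ?iota_uniq //; apply: Num.Theory.mulrIn (oner_neq0 F).
by rewrite size_map size_iota ltnn.
Qed.

(** A zero term could be deleted, leaving a decomposition of length [r - 1]. *)
Lemma minimal_term_neq0 (C : fieldType) (d r : nat) (f : {mpoly C[2]})
    (lambda alpha beta : 'I_r -> C) :
  (forall r', has_decomposition predT d f r' -> (r <= r')%N) ->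
  f = \sum_j lambda j *: (alpha j *: 'X_0 + beta j *: 'X_1) ^+ d ->
  forall j, lambda j *: (alpha j *: 'X_0 + beta j *: 'X_1) ^+ d != 0 :> {mpoly C[2]}.
Proof.
case: r lambda alpha beta => [|r] lambda alpha beta minr Df j; first by case: j.
apply/eqP => term0; suff /minr : has_decomposition predT d f r.
  by rewrite ltnn.
exists (lambda \o lift j), (alpha \o lift j), (beta \o lift j); split => //.
by rewrite Df (bigD1_ord j) //= term0 add0r.
Qed.

(* A natural number [m] with [alpha j + m * beta j != 0] for all [j] moves every
   node of the decomposition away from infinity. *)
Lemma rank_normal_form (C : numFieldType) (d r : nat) (f : {mpoly C[2]}) :
  (r.*2 <= d.+1)%N -> has_rank predT d f r ->
  exists (m : nat) (mu rho : 'I_r -> C),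
  [/\ injective rho, forall j, mu j != 0
    & f = \sum_j mu j *: ((1 - m%:R * rho j) *: 'X_0 + rho j *: 'X_1) ^+ d].
Proof.
move=> le_rd [[lambda [alpha [beta [_ Df]]]] minr].
(* An index [j] forces [1 <= r], hence [2 <= d + 1]. Positivity of [d] matters because [0 ^+ 0 = 1]:
   a zero linear form has to give a zero term. *)
have d_gt0 (j : 'I_r) : (0 < d)%N.
  rewrite -ltnS; apply: leq_trans le_rd.
  by rewrite (leq_double 1) (leq_ltn_trans _ (ltn_ord j)).
have nz_ab j : (alpha j)%:P + beta j *: 'X != 0 :> {poly C}.
  apply/eqP => ab0; have /eqP[] := minimal_term_neq0 minr Df j.
  have -> : alpha j = 0.
    by have := congr1 (fun p : {poly C} => p`_0) ab0; rewrite !coefE mulr0 addr0.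
  have -> : beta j = 0.
    by have := congr1 (fun p : {poly C} => p`_1) ab0; rewrite !coefE mulr1 add0r.
  by rewrite !scale0r addr0 expr0n (gtn_eqF (d_gt0 j)) scaler0.
have [m] : exists m : nat, ~~ root (\prod_j ((alpha j)%:P + beta j *: 'X)) m%:R.
  by apply: exists_nat_nonroot; apply/prodf_neq0 => j _; apply: nz_ab.
rewrite rootE horner_prod => /prodf_neq0 nz_m.
pose gamma j := alpha j + m%:R * beta j.
have nz_gamma j : gamma j != 0.
  by have := nz_m j isT; rewrite !hornerE mulrC.
(* Since [alpha j = gamma j - m * beta j], each linear form is [gamma j] times
   [(1 - m * rho j) x + rho j y], which becomes [x + rho j y] under [y := y + m x]. *)
pose mu j := lambda j * gamma j ^+ d; pose rho j := beta j / gamma j.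
have {}Df : f =
    \sum_j mu j *: ((1 - m%:R * rho j) *: 'X_0 + rho j *: 'X_1) ^+ d.
  rewrite Df; apply: eq_bigr => j _; rewrite -scalerA -exprZn scalerDr !scalerA.
  have -> : gamma j * rho j = beta j by rewrite mulrC divfK.
  by rewrite mulrBr mulr1 mulrCA [gamma j * _]mulrC divfK // addrK.
exists m, mu, rho; split=> //; last first.
  move=> j; have := minimal_term_neq0 minr Df j.
  by apply: contraNneq => ->; rewrite scale0r.
move=> j k eq_rho; apply/eqP/negP => /negP ne_jk.
(* If two nodes agree, their weights are merged at [k]; the term at [j] then vanishes, against
   minimality. *)
pose nu i := if i == j then 0 else if i == k then mu j + mu k else mu i.
have /minimal_term_neq0 : f =
    \sum_j nu j *: ((1 - m%:R * rho j) *: 'X_0 + rho j *: 'X_1) ^+ d.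
  rewrite Df (bigD1 j) // (bigD1 k) 1?eq_sym //= [RHS](bigD1 j) //.
  rewrite [in RHS](bigD1 k) 1?eq_sym //= /nu !eqxx scale0r add0r.
  rewrite [k == j]eq_sym (negPf ne_jk) eq_rho addrA -scalerDl; congr (_ + _).
  by apply: eq_bigr => i /andP[/negPf-> /negPf->].
by move=> /(_ minr j); rewrite /nu eqxx scale0r eqxx.
Qed.

(** * Moments as coefficients up to binomials *)

(* [dehomogenize m f] is the polynomial f(1, X + m). *)
Definition dehomogenize (C : fieldType) (m : nat) (f : {mpoly C[2]}) :
    {poly C} :=
  mmap polyC (fun i : 'I_2 => if i == 0 then 1 else 'X + (m%:R)%:P) f.

Lemma dehomogenize_over (C : fieldType) (K : divringClosed C) (m : nat)
    (f : {mpoly C[2]}) :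
  f \is a mpolyOver 2 K -> dehomogenize m f \is a polyOver K.
Proof.
move/mpolyOverP => Kf; rewrite /dehomogenize /mmap rpred_sum // => e _.
rewrite rpredM ?polyOverC // rpred_prod // => i _; rewrite rpredX //.
case: (i == 0); first exact: rpred1.
by rewrite rpredD ?polyOverX // polyOverC rpred_nat.
Qed.

(** Setting [x = 1], [y = X + m] turns the [j]-th linear form into [1 + rho j X], and the binomial
    theorem applies; for [i > d] both sides are 0. *)
Lemma coef_dehomogenize (C : fieldType) (d r m : nat) (mu rho : 'I_r -> C)
    (i : nat) :
  (dehomogenize m
     (\sum_j mu j *: ((1 - m%:R * rho j) *: 'X_0 + rho j *: 'X_1) ^+ d))`_i
  = 'C(d, i)%:R * \sum_j mu j * rho j ^+ i.
Proof.
rewrite /dehomogenize rmorph_sum coef_sum mulr_sumr; apply: eq_bigr => j _ /=.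
rewrite mmapZ rmorphXn rmorphD /= !mmapZ !mmapX !mmap1U /= coefCM mulr1.
have -> : (1 - m%:R * rho j)%:P + (rho j)%:P * ('X + (m%:R)%:P)
          = 1 + rho j *: 'X :> {poly C}.
  by rewrite mulrDr mul_polyC -polyCM addrCA -polyCD [m%:R * _]mulrC subrK addrC.
have -> : (1 + rho j *: 'X) ^+ d
          = \poly_(k < d.+1) (rho j ^+ k *+ 'C(d, k)) :> {poly C}.
  rewrite exprDn poly_def; apply: eq_bigr => k _.
  by rewrite expr1n mul1r exprZn scalerMnl.
rewrite coef_poly ltnS; case: leqP => [_ | lt_di].
  by rewrite -mulr_natl mulrCA.
by rewrite bin_small // mulr0 mul0r.
Qed.

(** * Descent of the decomposition to a splitting field *)

Lemma rank_descent (C : numClosedFieldType) (K : divringClosed C) (d r : nat)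
    (f : {mpoly C[2]}) :
  (r.*2 <= d.+1)%N -> f \is a mpolyOver 2 K -> has_rank predT d f r ->
  exists (S : divringClosed C) (n : nat),
    [/\ {subset K <= S}, has_rank S d f r, has_ext_degree K S n & (n %| r`!)%N].
Proof.
move=> le_rd Kf rank_f; have [_ min_r] := rank_f.
have [m [mu [rho [inj_rho nz_mu Df]]]] := rank_normal_form le_rd rank_f.
(* For [i > d] the divisor is 0 and the quotient is 0 by convention; only indices
   [i < r.*2 <= d + 1] are used below. *)
have Kc i : (dehomogenize m f)`_i / 'C(d, i)%:R \in K.
  by rewrite rpred_div ?rpred_nat // (polyOverP (dehomogenize_over m Kf)).
pose c i : subfield_type K := exist (fun x => x \in K) _ (Kc i).
pose iota : {rmorphism subfield_type K -> C} := val.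
have cE i : (i < r.*2)%N -> iota (c i) = \sum_j mu j * rho j ^+ i.
  move=> lt_ir; have le_id : (i <= d)%N by rewrite -ltnS (leq_trans lt_ir).
  rewrite /iota /= Df coef_dehomogenize mulrC mulKf //.
  by rewrite Num.Theory.pnatr_eq0 -lt0n bin_gt0.
have [p Dp] := node_poly_descent inj_rho nz_mu cE.
have sz_p : size p = r.+1.
  by rewrite -(size_map_poly iota) Dp -big_enum size_prod_XsubC size_enum_ord.
have nz_p : p != 0 by rewrite -size_poly_eq0 sz_p.
have [L [j [jE dvd_dim rootj]]] := splitting_embedding iota nz_p.
have {rootj}/fin_all_exists[rhoL rhoE] k : exists y, j y = rho k.
  apply: rootj; rewrite Dp rootE horner_prod (bigD1 k) //= hornerXsubC.
  by rewrite subrr mul0r.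
have inj_rhoL : injective rhoL.
  by move=> k l eq_kl; apply: inj_rho; rewrite -!rhoE eq_kl.
(* The weights descend to [L] rather than [K], because the Vandermonde matrix of the nodes has
   entries in [L]. *)
have /(weight_descent inj_rhoL) muL i : (i < r)%N ->
    j (c i)%:A = \sum_k mu k * j (rhoL k) ^+ i.
  move=> lt_ir; rewrite jE cE; last by rewrite -addnn ltn_addr.
  by apply: eq_bigr => k _; rewrite rhoE.
have [S memS] := image_subfield j.
exists S, (\dim {:L}); split.
- by move=> x Kx; apply/memS; exists (exist (fun x => x \in K) x Kx : subfield_type K)%:A.
(* Minimality passes from [C] to [S], since a decomposition over [S] is also one over [C]. *)
- split=> [|r' [lambda [alpha [beta [_ Df']]]]]; last first.
    by apply: min_r; exists lambda, alpha, beta.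
  have rhoS k : rho k \in S by apply/memS; exists (rhoL k).
  exists mu, (fun k => 1 - m%:R * rho k), rho; split=> // k.
  split; [exact/memS/muL | | exact: rhoS].
  by rewrite rpredB ?rpred1 // rpredM ?rpred_nat.
- by exists L, j.
- by move: dvd_dim; rewrite sz_p.
Qed.

Theorem theorem4p2 (R : realType) (K : divringClosed R[i]) (d r : nat)
    (f : {mpoly R[i][2]})
    (hr : r%:R < (d%:R + 2%:R) / 2%:R :> rat)
    (hf : binary_form K d f)
    (hrank : has_rank predT d f r) :
  exists (S : divringClosed R[i]) (n : nat),
    [/\ {subset K <= S},
        has_rank S d f r,
        has_ext_degree K S n
      & (n %| r`!)%N].
Proof.
case: hf => _ Kf; apply: rank_descent Kf hrank.
(* Clearing the denominator turns the rational bound into [r.*2 <= d.+1]. *)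
move: hr; rewrite Num.Theory.ltr_pdivlMr ?Num.Theory.ltr0n //.
by rewrite -natrM -natrD Num.Theory.ltr_nat muln2 addn2 ltnS.
Qed.
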